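(* Let $q$ be a prime power, $m\ge 1$, $n\ge 2$, and let $C$ be an $[n,n-1]$ cyclic code over $\mathbb{F}_{q^m}$ with generator polynomial $g(x)=x+g_0\in\mathbb{F}_{q^m}[x]$ (so $g(x)$ divides $x^n-1$). Then: 1. for every $r$ with $1\le r\le n-[\mathbb{F}_q(g_0):\mathbb{F}_q]$, one has $d_r(\lambda(C))=r$; 2. for every $r$ with $n+1-[\mathbb{F}_q(g_0):\mathbb{F}_q]\le r\le n-1$, the code $C$ is $r$-MRD.
   Context: An $[n,k]$ linear code over $\mathbb{F}_{q^m}$ is a $k$-dimensional $\mathbb{F}_{q^m}$-subspace $C$ of $\mathbb{F}_{q^m}^n$. It is cyclic with generator polynomial $g(x)$ (monic, dividing $x^n-1$, of degree $n-k$) if, identifying vectors with polynomials of degree $\le n-1$, $C$ is the ideal generated by $g(x)$ in $\mathbb{F}_{q^m}[x]/(x^n-1)$, i.e. $C=\{c(x)g(x) : c(x)\in\mathbb{F}_{q^m}[x],\ \deg c\le k-1\}$. For $1\le r\le k$, the $r$-th rank weight of $C$ (relative to $\mathbb{F}_q$) is $$d_r(\lambda(C))=\min\{\dim_{\mathbb{F}_{q^m}} V : V\in\Gamma(\mathbb{F}_{q^m}^n),\ \dim_{\mathbb{F}_{q^m}}(C\cap V)\ge r\},$$ where $\Gamma(\mathbb{F}_{q^m}^n)$ is the set of $\mathbb{F}_{q^m}$-linear subspaces $V\subset\mathbb{F}_{q^m}^n$ with $V^q=V$, and $V^q=\{(c_1^q,\dots,c_n^q) : (c_1,\dots,c_n)\in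 V\}$. An $[n,k]$ linear code $C$ is called $r$-MRD if $d_r(\lambda(C))=n-k+r$. *)

(* Defs.v *)
From HB Require Import structures.
From mathcomp Require Import all_boot all_order all_algebra all_field.

Set Implicit Arguments.
Unset Strict Implicit.
Unset Printing Implicit Defensive.

Import GRing.Theory.
Local Open Scope ring_scope.

(** The extension F_{q^m} / F_q is a finite field [F] of order [q = #|F|]
    together with a finite extension [L : fieldExtType F], so [m = \dim {:L}].
    Codes of length [n] are [L]-subspaces of ['rV[L]_n]; [\dim] of such a
    subspace is its dimension over [L]. *)

Section Codes.

Variables (F : finFieldType) (L : fieldExtType F) (n : nat).
Implicit Types (C V : {vspace 'rV[L]_n}) (g : {poly L}) (r d : nat).

(** A vector [v] is identified with [rVpoly v = \sum_i v 0 i *: 'X^i]. *)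
Definition cyclic_code C g : Prop :=
  [/\ g \is monic,
      g %| 'X^n - 1,
      (size g).-1 = (n - \dim C)%N
    & forall v : 'rV[L]_n,
        v \in C <-> exists2 c : {poly L}, (size c <= \dim C)%N & rVpoly v = c * g].

Definition qpower (v : 'rV[L]_n) : 'rV[L]_n := map_mx (fun x => x ^+ #|F|) v.

(** The equality of sets V^q = V; being in V^q is being the [qpower] of an
    element of V. *)
Definition Galois_closed V : Prop :=
  forall v : 'rV[L]_n, (exists2 c, c \in V & v = qpower c) <-> v \in V.

(** [rank_weight C r d] states d_r(lambda(C)) = d: the minimum of [\dim V]
    over the V admissible for [r] is attained and equals [d]. *)
Definition admissible C r V : Prop :=
  Galois_closed V /\ (r <= \dim (C :&: V))%N.

Definition rank_weight C r d : Prop :=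
  (exists2 V, admissible C r V & \dim V = d)
  /\ (forall V, admissible C r V -> (d <= \dim V)%N).

Definition MRD C r : Prop := rank_weight C r (n - \dim C + r)%N.

End Codes.

(* Main.v *)
(** Let [a = - g0], so that [C] is the hyperplane of polynomials of degree [< n]
    vanishing at [a], and let [s] be the degree of [a] over [F]. A Galois closed
    [V] contained in [C] vanishes at every conjugate of [a], hence consists of
    multiples of the minimal polynomial of [a], and [\dim V <= n - s]. So for
    [r > n - s] no Galois closed [V] of dimension [r] lies in the hyperplane [C],
    while any one of dimension [r + 1] meets it in dimension at least [r]; for
    [r <= n - s], the multiples [c * minPoly 1 a] with [deg c < r] form a Galois
    closed subspace of [C] of dimension [r]. *)

Require Import Defs.
From HB Require Import structures.
From mathcomp Require Import all_boot all_order all_algebra all_field.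
From mathcomp Require Import pgroup abelian zify.

Set Implicit Arguments.
Unset Strict Implicit.
Unset Printing Implicit Defensive.

Import GRing.Theory.
Local Open Scope ring_scope.

Lemma size_rVpoly (R : nzRingType) n (v : 'rV[R]_n) : (size (rVpoly v) <= n)%N.
Proof. exact: size_poly. Qed.

(** * The Frobenius map of [L] over [F] and conjugates *)

Section Frobenius.

Variables (F : finFieldType) (L : fieldExtType F).

Definition frob (x : L) : L := x ^+ #|F|.

(** The additive group of [F] is elementary abelian, so its order is a power of the characteristic;
    this is what makes [frob] additive. *)
Lemma card_pnat_pchar : [pchar L].-nat #|F|.
Proof.
have [p _ charFp] := finPcharP F.
have: p.-nat #|F|.
  by rewrite -cardsT; apply: abelem_pgroup (fin_ring_pchar_abelem charFp).
by apply: sub_in_pnat => r _ /eqnP->; rewrite pchar_lalg.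
Qed.

Lemma frob_is_nmod_morphism : nmod_morphism frob.
Proof.
split=> [|x y]; rewrite /frob; last exact: exprDn_pchar card_pnat_pchar.
by rewrite expr0n gtn_eqF // (ltnW (finNzRing_gt1 F)).
Qed.

Lemma frob_is_monoid_morphism : monoid_morphism frob.
Proof. by split=> [|x y]; rewrite /frob ?expr1n ?exprMn. Qed.

HB.instance Definition _ := GRing.isNmodMorphism.Build L L frob
  frob_is_nmod_morphism.
HB.instance Definition _ := GRing.isMonoidMorphism.Build L L frob
  frob_is_monoid_morphism.

Lemma iter_frob j x : iter j frob x = x ^+ (#|F| ^ j).
Proof.
by elim: j => [|j IHj]; rewrite ?expr1 // iterS IHj /frob -exprM expnSr.
Qed.

Lemma iter_frob_dim x : iter (\dim {:L}) frob x = x.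
Proof.
by rewrite iter_frob; apply/eqP; rewrite -Fermat's_little_theorem memvf.
Qed.

Lemma mem1v_frob x : (x \in 1%VS) = (frob x == x).
Proof. by rewrite (Fermat's_little_theorem 1%AS) dimv1 expn1. Qed.

Lemma map_poly_frob (p : {poly L}) :
  p \is a polyOver 1%VS = (map_poly frob p == p).
Proof.
apply/polyOverP/eqP => [Fp | pE i].
  by apply/polyP => i; rewrite coef_map /=; apply/eqP; rewrite -mem1v_frob.
by rewrite mem1v_frob -[in X in _ == X]pE coef_map.
Qed.

(** [frob] permutes the distinct conjugates of [a], so the monic polynomial [h] with these as simple
    roots has coefficients in [F]. It vanishes at [a], hence is a multiple of the minimal
    polynomial, and it divides [p] because [p] vanishes at all its roots. *)
Lemma minPoly_dvdp_conjugates (a : L) (p : {poly L}) :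
  (forall j, root p (iter j frob a)) -> minPoly 1 a %| p.
Proof.
move=> pa; pose rs := undup (traject frob a (\dim {:L})).
have rs_frob : perm_eq (map frob rs) rs.
  have injf : injective frob by exact: fmorph_inj.
  have uf : uniq (map frob rs) by rewrite map_inj_uniq ?undup_uniq.
  apply: uniq_perm; rewrite ?undup_uniq //.
  have sub : {subset map frob rs <= rs}.
    move=> _ /mapP[x + ->]; rewrite !mem_undup => /trajectP[j ltj ->].
    rewrite -iterS; apply/trajectP.
    have [lt1 | ] := ltnP j.+1 (\dim {:L}); first by exists j.+1.
    (* The last conjugate wraps around: its image is the iterate of order [\dim {:L}], which is [a]
       itself, at index 0. *)
    rewrite leq_eqVlt ltnNge ltj orbF => /eqP<-.
    exists 0%N; rewrite ?iter_frob_dim //.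
    exact: leq_trans ltj.
  (* An injective map of a finite set into itself is onto. *)
  by have [] := uniq_min_size uf sub; rewrite ?size_map.
pose h := \prod_(x <- rs) ('X - x%:P).
have hF : h \is a polyOver 1%VS.
  rewrite map_poly_frob map_prod_XsubC /h.
  rewrite -(big_map frob xpredT (fun y => 'X - y%:P)).
  by rewrite (perm_big _ rs_frob).
have dim_gt0 : (0 < \dim {:L})%N by exact: adim_gt0.
apply: dvdp_trans (_ : h %| p).
  apply: (@minPoly_dvdp _ _ 1%AS) => //; rewrite root_prod_XsubC mem_undup.
  by apply/trajectP; exists 0%N.
apply: uniq_roots_dvdp; last by rewrite uniq_rootsE undup_uniq.
apply/allP => x; rewrite mem_undup => /trajectP[j _ ->]; exact: pa.
Qed.

(** * Galois closed spaces and spaces of multiples of a polynomial *)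

Section Codes.

Variable n : nat.
Implicit Types (V : {vspace 'rV[L]_n}) (v : 'rV[L]_n).

Lemma rVpoly_qpower v : rVpoly (qpower v) = map_poly frob (rVpoly v).
Proof.
apply/polyP => i; rewrite coef_map !coef_rVpoly.
by case: insub => [j|] /=; rewrite ?mxE ?rmorph0.
Qed.

Lemma iter_qpower_dim v : iter (\dim {:L}) (@qpower F L n) v = v.
Proof.
suff E j : iter j (@qpower F L n) v = map_mx (iter j frob) v.
  by rewrite E; apply/rowP => i; rewrite mxE iter_frob_dim.
by elim: j => [|j /= ->]; apply/rowP => i; rewrite !mxE.
Qed.

(** [qpower] has finite order, so its inverse is one of its iterates and preserves [V] too. *)
Lemma Galois_closedP V : (forall v, v \in V -> qpower v \in V) -> Galois_closed V.
Proof.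
move=> closedV v; split=> [[c cV ->] | vV]; first exact: closedV.
exists (iter (\dim {:L}).-1 (@qpower F L n) v).
  by elim: _.-1 => //= j; exact: closedV.
by rewrite -iterS prednK ?iter_qpower_dim ?adim_gt0.
Qed.

(** Each [v] in [V] is [qpower c] with [c] in [V], and a root of [c] becomes a root of [v] under
    [frob]. Induction on [j] thus reaches every conjugate of [a]. *)
Lemma Galois_closed_root V (a : L) : Galois_closed V ->
  (forall v, v \in V -> root (rVpoly v) a) ->
  forall v, v \in V -> minPoly 1 a %| rVpoly v.
Proof.
move=> closedV Va v vV; apply: minPoly_dvdp_conjugates => j.
elim: j v vV => [|j IHj] v; first exact: Va.
move=> /closedV[c cV ->]; rewrite rVpoly_qpower iterS.
by rewrite fmorph_root IHj.
Qed.

(** The cofactor is encoded as a row of length [r], so that the multiples form the image of a linear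
    map and injectivity yields their dimension. [poly_rV] truncates nothing as long as
    [r + deg g <= n]. *)
Definition multiple (g : {poly L}) r (u : 'rV[L]_r) : 'rV[L]_n :=
  poly_rV (rVpoly u * g).

Lemma multiple_is_linear g r : linear (@multiple g r).
Proof. by move=> k u v; rewrite /multiple !linearP mulrDl -scalerAl linearP. Qed.

HB.instance Definition _ g r := GRing.isLinear.Build L 'rV[L]_r 'rV[L]_n _
  (@multiple g r) (@multiple_is_linear g r).

Definition multiples g r : {vspace 'rV[L]_n} := limg (linfun (@multiple g r)).

Section Multiples.

Variables (g : {poly L}) (r : nat).
Hypotheses (g_monic : g \is monic) (le_rg_n : (r + (size g).-1 <= n)%N).

Lemma size_multiple (c : {poly L}) : (size c <= r)%N -> (size (c * g)%R <= n)%N.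
Proof.
move=> le_cr; apply: leq_trans (size_polyMleq _ _) _.
have := le_rg_n; have : (0 < size g)%N by rewrite size_poly_gt0 monic_neq0.
by case: (size g) => // k _ /=; rewrite addnS /=; apply: leq_trans; rewrite leq_add2r.
Qed.

Lemma multiplesP v :
  reflect (exists2 c : {poly L}, (size c <= r)%N & rVpoly v = c * g)
          (v \in multiples g r).
Proof.
apply: (iffP memv_imgP) => [[u _ ->] | [c le_cr vE]].
  exists (rVpoly u); first exact: size_poly.
  by rewrite lfunE /= poly_rV_K // size_multiple ?size_poly.
exists (poly_rV c); rewrite ?memvf // lfunE /= /multiple poly_rV_K // -vE.
by rewrite rVpolyK.
Qed.

Lemma dim_multiples : \dim (multiples g r) = r.
Proof.
rewrite limg_dim_eq; first by rewrite dimvf; apply: mul1n.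
apply/eqP; rewrite capfv; apply/lker0P => u v; rewrite !lfunE /= /multiple.
move=> /(congr1 rVpoly); rewrite !poly_rV_K ?size_multiple ?size_poly //.
by move=> /(mulIf (monic_neq0 g_monic)); apply: (can_inj rVpolyK).
Qed.

Lemma Galois_closed_multiples : g \is a polyOver 1%VS ->
  Galois_closed (multiples g r).
Proof.
rewrite map_poly_frob => /eqP gF; apply: Galois_closedP => v.
move=> /multiplesP[c le_cr vE]; apply/multiplesP; exists (map_poly frob c).
  by rewrite size_map_poly.
by rewrite rVpoly_qpower vE rmorphM /= gF.
Qed.

(** With the section hypothesis this forces [r = n - deg g], the exact room left for a cofactor. *)
Lemma sub_multiples V : (n <= r + (size g).-1)%N ->
  (forall v, v \in V -> g %| rVpoly v) -> (V <= multiples g r)%VS.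
Proof.
move=> le_n_rg Vg; apply/subvP => v /Vg/dvdpP[c vE]; apply/multiplesP; exists c => //.
have [-> | c0] := eqVneq c 0; first by rewrite size_poly0.
have := size_rVpoly v; rewrite vE size_Mmonic //; move: le_n_rg.
have : (0 < size g)%N by rewrite size_poly_gt0 monic_neq0.
by move: (size g) (size c) => [//|k] l _; rewrite addnS /= => ? ?; lia.
Qed.

End Multiples.

Lemma dim_minPoly_Galois_closed V (a : L) :
  (\dim <<1; a>> <= n)%N -> Galois_closed V ->
  (forall v, v \in V -> root (rVpoly v) a) ->
  (\dim V <= n - \dim <<1; a>>)%N.
Proof.
move=> le_sn closedV Va; have dvdV := Galois_closed_root closedV Va.
have sz : (size (minPoly 1 a)).-1 = \dim <<1; a>>.
  by rewrite size_minPoly adjoin_degreeE dimv1 divn1.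
have le1 : (n - \dim <<1; a>> + (size (minPoly 1 a)).-1 <= n)%N by rewrite sz subnK.
have le2 : (n <= n - \dim <<1; a>> + (size (minPoly 1 a)).-1)%N by rewrite sz subnK.
rewrite -[leqRHS](dim_multiples (monic_minPoly 1 a) le1); apply: dimvS.
exact: (sub_multiples (monic_minPoly 1 a) le1 le2).
Qed.

End Codes.
End Frobenius.

(** * Codes of dimension [n - 1] *)

Lemma cyclic_code_root (F : finFieldType) (L : fieldExtType F) (n : nat)
    (C : {vspace 'rV[L]_n}) (a : L) :
  \dim C = n.-1 -> cyclic_code C ('X - a%:P) ->
  forall v, (v \in C) = root (rVpoly v) a.
Proof.
move=> dimC [_ _ _ CE] v; rewrite -dvdp_XsubCl.
apply/idP/dvdpP => [/CE[c _ ->] | [c vE]]; first by exists c.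
apply/CE; exists c => //; rewrite dimC.
have [-> | c0] := eqVneq c 0; first by rewrite size_poly0.
have := size_rVpoly v; rewrite vE size_Mmonic ?monicXsubC // size_XsubC addn2 /=.
by case: n {v vE CE dimC C}.
Qed.

Theorem corollary1 (F : finFieldType) (L : fieldExtType F) (n : nat)
    (hn : (2 <= n)%N) (C : {vspace 'rV[L]_n}) (g0 : L)
    (hC : \dim C = (n - 1)%N)
    (hg : cyclic_code C ('X + g0%:P)) :
  (forall r : nat,
     (1 <= r <= n - \dim <<1%VS; g0>>)%N -> rank_weight C r r)
  /\
  (forall r : nat,
     (n + 1 - \dim <<1%VS; g0>> <= r <= n - 1)%N -> MRD C r).
Proof.
have le_cap V r : admissible C r V -> (r <= \dim V)%N.
  by case=> _ /leq_trans; apply; rewrite dimvS ?capvSr.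
pose a := - g0; have aE : <<1; g0>>%VS = <<1; a>>%VS.
  apply/eqP; rewrite eqEsubv; apply/andP; split; apply/FadjoinP; split;
    rewrite ?sub_adjoin1v ?subv_adjoin ?rpredN ?memv_adjoin //.
  by rewrite -(opprK g0) rpredN memv_adjoin.
rewrite aE {aE}; set s := \dim _.
have {}hg : cyclic_code C ('X - a%:P) by rewrite polyCN opprK.
have a_n : root ('X^n - 1) a by case: hg => _; rewrite dvdp_XsubCl.
have CE := cyclic_code_root (etrans hC (subn1 n)) hg.
have sz : (size (minPoly 1 a)).-1 = s.
  by rewrite size_minPoly adjoin_degreeE dimv1 divn1.
(* [X^n - 1] has coefficients in [F] and vanishes at [a], so the minimal polynomial divides it.
   Hence the natural subtraction [n - s] does not truncate. *)
have le_sn : (s <= n)%N.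
  rewrite -sz -ltnS prednK ?size_poly_gt0 ?monic_neq0 ?monic_minPoly //.
  rewrite -(size_XnsubC (1 : L) (ltnW hn)); apply: dvdp_leq.
    by rewrite monic_neq0 ?monicXnsubC // ltnW.
  apply: minPoly_dvdp a_n.
  by rewrite rpredB ?rpredX ?polyOverX ?polyOverC ?rpred1 // mem1v.
split=> r /andP[].
  move=> _ le_r; split; last by move=> V; apply: le_cap.
  have le_n : (r + (size (minPoly 1 a)).-1 <= n)%N.
    by rewrite sz -(subnK le_sn) leq_add2r.
  have mon := monic_minPoly 1 a.
  exists (multiples n (minPoly 1 a) r); last exact: dim_multiples.
  split; first exact: (Galois_closed_multiples mon le_n (minPolyOver 1 a)).
  rewrite (capv_idPr _) ?dim_multiples //.
  apply/subvP => v /(multiplesP mon le_n)[c _ vE].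
  by rewrite CE vE rootM root_minPoly orbT.
move=> lt_r le_r.
rewrite /MRD; have -> : (n - \dim C + r = r.+1)%N by rewrite hC; lia.
split=> [|V admV].
  (* Witness: all polynomials of degree at most [r], as multiples of 1; they fit in length [n] since
     [r <= n - 1]. *)
  have le_n : (r.+1 + (size (1%R : {poly L})).-1 <= n)%N by rewrite size_poly1; lia.
  have dimV := dim_multiples (monic1 L) le_n.
  exists (multiples n 1 r.+1) => //; split.
    by apply: Galois_closed_multiples; rewrite ?rpred1 ?monic1.
  have := dimv_sum_cap C (multiples n 1 r.+1); rewrite dimV hC.
  have := dimvS (subvf (C + multiples n 1 r.+1)).
  by rewrite dimvf [dim _]mul1n; lia.
(* Only [\dim V = r] is left to exclude; it would put [V] inside [C]. *)
rewrite ltn_neqAle le_cap // andbT; apply/eqP => rE.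
have [closedV le_rcap] := admV.
have VC : (V <= C)%VS.
  by apply/capv_idPr/eqP; rewrite eqEdim capvSr -rE.
have : (\dim V <= n - s)%N.
  by apply: dim_minPoly_Galois_closed => // v /(subvP VC); rewrite CE.
by rewrite -rE; lia.
Qed.
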